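(* Let $P$ be an irreducible minuscule poset and let $k\in\mathbb{N}$ with $k\le\mathrm{width}(P)$. Then, with $\mathcal{A}_k(P)$ ordered by $\le_k$: (i) if $P\cong[a]\times[b]$, then $\mathcal{A}_k(P)\cong\mathcal{C}(a,k)\times\mathcal{C}(b,k)$; (ii) if $P\cong J([n]\times[2])$, then $\mathcal{A}_k(P)\cong\mathcal{A}_k(\mathcal{C}(n+2,2))\cong\mathcal{C}(n+2,2k)$; (iii) if $P\cong J^m([2]\times[2])$ with $m\in\mathbb{N}$, then $\mathcal{A}_k(P)$ is a singleton if $k\in\{0,2\}$ and $\mathcal{A}_k(P)\cong P$ if $k=1$; (iv) if $P\cong J^2([2]\times[3])$, then $\mathcal{A}_k(P)$ is a singleton if $k=0$, $\mathcal{A}_k(P)\cong P$ if $k=1$, and $\mathcal{A}_k(P)\cong J^3([2]\times[2])$ if $k=2$; (v) if $P\cong J^3([2]\times[3])$, then $\mathcal{A}_k(P)$ is a singleton if $k\in\{0,3\}$ and $\mathcal{A}_k(P)\cong P$ if $k\in\{1,2\}$; (vi) $\mathcal{A}_k(P)$ is a distributive lattice under $\le_k$.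
   Context: $[n]=\{1,\dots,n\}$ with its natural order; products of posets carry the product order. $J(Q)$ is the poset of order ideals of $Q$ under inclusion, $J^0(Q)=Q$ and $J^{m+1}(Q)=J(J^m(Q))$. The irreducible minuscule posets are exactly the posets isomorphic to one of $[a]\times[b]$, $J([n]\times[2])$, $J^m([2]\times[2])$, $J^2([2]\times[3])$, $J^3([2]\times[3])$, where $a,b,n\in\mathbb{Z}_+$ and $m\in\mathbb{N}$. $\mathrm{width}(P)$ is the maximum size of an antichain of $P$. $\mathcal{A}_k(P)$ is the set of antichains of $P$ of size $k$; for $A,B\in\mathcal{A}_k(P)$, $A\prec_k B$ means $A\setminus B=\{a\}$, $B\setminus A=\{b\}$ are singletons with $a<_P b$, and $\le_k$ is the reflexive transitive closure of $\prec_k$. For $k\le n$, $\mathcal{C}(n,k)$ is the set of $k$-element subsets of $[n]$ written as increasing sequences $(x_1<\dots<x_k)$, ordered by $\mathbf{x}\le\mathbf{y}$ iff $x_i\le y_i$ for all $i$. *)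

(* Defs.v *)
From mathcomp Require Import all_boot.
Set Implicit Arguments. Unset Strict Implicit. Unset Printing Implicit Defensive.

(* A finite set equipped with a (boolean) binary relation; posets are such
   structures whose relation is a partial order. *)
Record fposet := FPoset { fcar :> finType; frl : rel fcar }.

Definition fle (P : fposet) : rel P := @frl P.
Definition flt (P : fposet) : rel P := fun x y => fle x y && (x != y).

(* [n] = {1,...,n} with natural order; realised as 'I_n (shift by one). *)
Definition chain (n : nat) : fposet := @FPoset 'I_n (fun i j => (i <= j)%N).

Definition prodP (P Q : fposet) : fposet :=
  @FPoset (P * Q)%type (fun x y => fle x.1 y.1 && fle x.2 y.2).

Definition is_ideal (Q : fposet) (A : {set Q}) : bool :=
  [forall x : Q, forall y : Q, (fle y x && (x \in A)) ==> (y \in A)].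

Definition J (Q : fposet) : fposet :=
  @FPoset {A : {set Q} | is_ideal A} (fun A B => val A \subset val B).

Fixpoint Jpow (m : nat) (Q : fposet) : fposet :=
  match m with 0 => Q | m'.+1 => J (Jpow m' Q) end.

Definition is_porder (P : fposet) : Prop :=
  [/\ forall x : P, fle x x,
      forall x y : P, fle x y -> fle y x -> x = y &
      forall x y z : P, fle x y -> fle y z -> fle x z].

Definition iso (P Q : fposet) : Prop :=
  exists f : P -> Q, bijective f /\ forall x y : P, fle x y = fle (f x) (f y).

Definition antichain (P : fposet) (A : {set P}) : bool :=
  [forall x in A, forall y in A, fle x y ==> (x == y)].

Definition width (P : fposet) : nat := \max_(A : {set P} | antichain A) #|A|.

Definition Ak_car (P : fposet) (k : nat) : finType :=
  {A : {set P} | antichain A && (#|A| == k)}.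

Definition prec_k (P : fposet) (k : nat) : rel (Ak_car P k) :=
  fun A B => [exists a : P, exists b : P,
     [&& (val A :\: val B == [set a]), (val B :\: val A == [set b]) & flt a b]].

Definition Ak (P : fposet) (k : nat) : fposet :=
  @FPoset (Ak_car P k) (connect (@prec_k P k)).

Definition incseq (n : nat) (A : {set 'I_n}) : seq nat :=
  sort leq (map (@nat_of_ord n) (enum A)).

Definition Cnk (n k : nat) : fposet :=
  @FPoset {A : {set 'I_n} | #|A| == k}
    (fun A B => [forall i : 'I_k, nth 0 (incseq (val A)) i <= nth 0 (incseq (val B)) i]).

Definition is_glb (L : fposet) (m x y : L) : Prop :=
  fle m x /\ fle m y /\ forall z : L, fle z x -> fle z y -> fle z m.
Definition is_lub (L : fposet) (j x y : L) : Prop :=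
  fle x j /\ fle y j /\ forall z : L, fle x z -> fle y z -> fle j z.

Definition distributive_lattice (L : fposet) : Prop :=
  is_porder L /\
  exists (mt jn : L -> L -> L),
    (forall x y, is_glb (mt x y) x y) /\ (forall x y, is_lub (jn x y) x y) /\
    (forall x y z, mt x (jn y z) = jn (mt x y) (mt x z)).

Definition irreducible_minuscule (P : fposet) : Prop :=
  (exists a b, 0 < a /\ 0 < b /\ iso P (prodP (chain a) (chain b))) \/
  (exists n, 0 < n /\ iso P (J (prodP (chain n) (chain 2)))) \/
  (exists m, iso P (Jpow m (prodP (chain 2) (chain 2)))) \/
  iso P (Jpow 2 (prodP (chain 2) (chain 3))) \/
  iso P (Jpow 3 (prodP (chain 2) (chain 3))).

(* Main.v *)
(* An antichain of size k in a subset of [a] x [b] is a pair of increasing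
   k-sequences: the first coordinates, and the second coordinates read
   backwards. A step of [prec_k] gives a coordinatewise increasing
   bijection of antichains, hence a pointwise inequality between the sorted
   sequences, and conversely a pointwise inequality is climbed one entry at
   a time, starting at the largest index where the sequences differ. With all
   of [a] x [b] this is (i). For (ii), J([n] x [2]) and C(n+2, 2) are both the
   poset of pairs x < y in [n+2], where the two sequences concatenate to a
   single increasing 2k-sequence. For (iii), having exactly one incomparable
   pair passes from P to J(P). In (iv) and (v) the posets J^m([2] x [3]) are
   tabulated by enumerating ideals, and the isomorphisms are checked on explicit
   lists of antichains. *)

Require Import Defs.
From mathcomp Require Import all_boot.

Set Implicit Arguments.
Unset Strict Implicit.
Unset Printing Implicit Defensive.

(** * Isomorphisms and antichain posets *)

Lemma iso_sym (P Q : fposet) : iso P Q -> iso Q P.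
Proof.
case=> f [[g gK fK] fle_f]; exists g; split; first by exists f.
by move=> x y; rewrite fle_f !fK.
Qed.

Lemma iso_trans (Q P R : fposet) : iso P Q -> iso Q R -> iso P R.
Proof.
case=> f [f_bij fle_f] [g [g_bij fle_g]]; exists (g \o f).
by split=> [|x y]; [apply: bij_comp | rewrite fle_f fle_g].
Qed.

Lemma inj_surj_bij (S T : finType) (f : S -> T) :
  injective f -> (forall y, exists x, f x = y) -> bijective f.
Proof.
move=> f_inj f_surj.
have ex y : exists x, f x == y by have [x <-] := f_surj y; exists x.
have fK : cancel (fun y => xchoose (ex y)) f by move=> y; apply/eqP/(xchooseP (ex y)).
by exists (fun y => xchoose (ex y)) => // x; apply: f_inj; rewrite fK.
Qed.

(** An order embedding of a poset is injective: equal images are related both ways, and antisymmetry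
    applies. Surjectivity is then all that an isomorphism has left to check. *)
Lemma iso_surj (P Q : fposet) (f : P -> Q) :
    is_porder P -> (forall x y, fle x y = fle (f x) (f y)) ->
    (forall y, exists x, f x = y) ->
  iso P Q.
Proof.
case=> P_refl P_anti _ fle_f f_surj; exists f; split=> //.
apply: inj_surj_bij => // x y eq_f.
by apply: P_anti; rewrite fle_f eq_f -fle_f.
Qed.

Lemma iso_porder (P Q : fposet) : iso P Q -> is_porder P -> is_porder Q.
Proof.
move=> /iso_sym[f [f_bij fle_f]] [P_refl P_anti P_trans]; split=> [x|x y|x y z].
- by rewrite fle_f.
- by rewrite !fle_f => le_xy le_yx; apply/(bij_inj f_bij)/P_anti.
- by rewrite !fle_f; apply: P_trans.
Qed.

Lemma iso_card (P Q : fposet) : iso P Q -> #|P| = #|Q|.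
Proof. by case=> f [/bij_eq_card]. Qed.

Lemma chain_porder n : is_porder (chain n).
Proof.
split=> [x|x y|x y z]; rewrite /fle /=; first exact: leqnn.
  by move=> le_xy le_yx; apply/val_inj/anti_leq/andP.
exact: leq_trans.
Qed.

Lemma prodP_porder (P Q : fposet) :
  is_porder P -> is_porder Q -> is_porder (prodP P Q).
Proof.
move=> [Pr Pa Pt] [Qr Qa Qt]; split=> [[x y]|[x y] [x' y']|[x y] [x' y'] [x2 y2]];
  rewrite /fle /=.
- by apply/andP; split; [apply: Pr | apply: Qr].
- move=> /andP[a b] /andP[c d].
  by rewrite (Pa _ _ a c) (Qa _ _ b d).
- move=> /andP[a b] /andP[c d].
  by apply/andP; split; [apply: Pt c | apply: Qt d].
Qed.

Lemma J_porder (Q : fposet) : is_porder (J Q).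
Proof.
split=> [A|A B|A B C]; rewrite /fle /=; first exact: subxx.
  by move=> AB BA; apply/val_inj/eqP; rewrite eqEsubset AB.
exact: subset_trans.
Qed.

Lemma prodP_iso (P Q P' Q' : fposet) :
  iso P P' -> iso Q Q' -> iso (prodP P Q) (prodP P' Q').
Proof.
move=> [f [[f' fK f'K] fle_f]] [g [[g' gK g'K] fle_g]].
exists (fun x => (f x.1, g x.2)); split.
  by exists (fun x => (f' x.1, g' x.2)) => [] [x y] /=; rewrite ?fK ?gK ?f'K ?g'K.
by move=> x y; congr (_ && _); [apply: fle_f | apply: fle_g].
Qed.

Lemma idealP (Q : fposet) (A : {set Q}) :
  reflect (forall x y, fle y x -> x \in A -> y \in A) (is_ideal A).
Proof.
apply: (iffP forallP) => [AA x y le_yx Ax|AA x].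
  by have /forallP/(_ y)/implyP := AA x; apply; rewrite le_yx.
by apply/forallP => y; apply/implyP => /andP[]; apply: AA.
Qed.

Lemma antichainP (P : fposet) (A : {set P}) :
  reflect {in A &, forall x y, fle x y -> x = y} (antichain A).
Proof.
apply: (iffP forall_inP) => [AA x y Ax Ay le_xy|AA x Ax].
  by have /forall_inP/(_ y Ay)/implyP/(_ le_xy)/eqP := AA x Ax.
by apply/forall_inP => y Ay; apply/implyP => /(AA x y Ax Ay) ->.
Qed.

Lemma J_iso (P Q : fposet) : iso P Q -> iso (J P) (J Q).
Proof.
move=> /iso_sym[f [[g fK gK] fle_f]].
have pre_ideal (A : J P) : is_ideal (f @^-1: val A).
  apply/idealP => x y; rewrite !inE fle_f.
  exact: (idealP _ (valP A)).
apply: (@iso_surj _ _ (fun A : J P => exist _ (f @^-1: val A) (pre_ideal A) : J Q)).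
- exact: J_porder.
- move=> A B; rewrite /fle /=; apply/subsetP/subsetP => AB x.
    by rewrite !inE; apply: AB.
  by have := AB (g x); rewrite !inE gK.
- move=> B.
  have im_ideal : is_ideal (g @^-1: val B).
    apply/idealP => x y; rewrite !inE => le_yx.
    by apply: (idealP _ (valP B)); rewrite fle_f !gK.
  exists (exist _ (g @^-1: val B) im_ideal); apply: val_inj => /=.
  by apply/setP => x; rewrite !inE fK.
Qed.

Lemma Jpow_iso m (P Q : fposet) : iso P Q -> iso (Jpow m P) (Jpow m Q).
Proof. by move=> PQ; elim: m => //= m; apply: J_iso. Qed.

(** * The order on antichains of a fixed size *)

Lemma precP (P : fposet) k (A B : Ak_car P k) :
  reflect (exists a b, [/\ val A :\: val B = [set a],
             val B :\: val A = [set b] & flt a b])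
          (prec_k A B).
Proof.
apply: (iffP existsP) => [[a /existsP[b /and3P[/eqP ? /eqP ? ?]]]|[a [b [AB BA ab]]]].
  by exists a, b.
by exists a; apply/existsP; exists b; rewrite AB BA !eqxx.
Qed.

Lemma connect_homo (S T : finType) (e : rel S) (e' : rel T) (F : S -> T) :
    (forall x y, e x y -> e' (F x) (F y)) ->
  forall x y, connect e x y -> connect e' (F x) (F y).
Proof.
move=> eF x y /connectP[p]; elim: p x => [|z p IHp] x /=.
  by move=> _ ->; apply: connect0.
move=> /andP[/eF e_xz pth] /IHp yz.
exact: connect_trans (connect1 e_xz) (yz pth).
Qed.

Lemma Ak_iso k (P Q : fposet) : iso P Q -> iso (Ak P k) (Ak Q k).
Proof.
move=> isoPQ; have [f [[g fK gK] fle_f]] := isoPQ.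
have gle_g x y : fle x y = fle (g x) (g y) by rewrite fle_f !gK.
(* Preimages are set up for arbitrary mutually inverse maps, so that the same construction serves
   for [f] and for [g]. Both pullbacks preserve [prec_k], and since they are mutually inverse they
   also reflect [connect]. *)
have pre (R T : fposet) (u : R -> T) (u' : T -> R) (uK : cancel u u') (u'K : cancel u' u)
    (fle_u : forall x y, fle x y = fle (u x) (u y)) (A : Ak T k) :
    antichain (u @^-1: val A) && (#|u @^-1: val A| == k).
  case/andP: (valP A) => A_anti A_card; rewrite on_card_preimset ?A_card ?andbT.
    apply/antichainP => x y; rewrite !inE fle_u => Ax Ay le_xy.
    exact/(can_inj uK)/(antichainP _ A_anti).
  by apply: onW_bij; exists u'.
pose pb R T u u' uK u'K fle_u (A : Ak T k) : Ak R k :=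
  exist _ (u @^-1: val A) (pre R T u u' uK u'K fle_u A).
have pb_prec R T u u' uK u'K fle_u A B :
    prec_k A B -> prec_k (@pb R T u u' uK u'K fle_u A) (@pb R T u u' uK u'K fle_u B).
  move=> /precP[a [b [AB BA /andP[ab neq_ab]]]]; apply/precP; exists (u' a), (u' b).
  rewrite /= -!preimsetD AB BA; split.
  - by apply/setP => x; rewrite !inE (can2_eq uK u'K).
  - by apply/setP => x; rewrite !inE (can2_eq uK u'K).
  - by rewrite /flt fle_u !u'K ab (inj_eq (can_inj u'K)).
exists (pb _ _ g f gK fK gle_g); split.
  exists (pb _ _ f g fK gK fle_f) => A; apply: val_inj; apply/setP => x;
  by rewrite !inE ?fK ?gK.
move=> A B; apply/idP/idP.
  exact/connect_homo/pb_prec.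
have pbK C : pb _ _ f g fK gK fle_f (pb _ _ g f gK fK gle_g C) = C.
  by apply: val_inj; apply/setP => x; rewrite !inE fK.
move=> /(connect_homo (pb_prec _ _ f g fK gK fle_f)); rewrite !pbK.
exact.
Qed.

Lemma prec_irr (P : fposet) k (A : Ak_car P k) : prec_k A A = false.
Proof.
by apply/precP => -[a [b [+ _ _]]]; rewrite setDv => /setP/(_ a); rewrite !inE eqxx.
Qed.

(** The common criterion behind the computations of [Ak]. A chain of [prec_k] steps climbs in [Q] by
    the first order condition. By the second, a strict inequality in [Q] can be entered by one step
    that stays below its upper end, and finiteness of [Q] lets this be repeated until that end is
    reached. *)
Lemma Ak_model (P Q : fposet) k (h : Q -> Ak P k) :
    is_porder Q -> injective h -> (forall A, exists q, h q = A) ->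
    (forall q q', prec_k (h q) (h q') -> fle q q') ->
    (forall q q', fle q q' -> q != q' ->
       exists2 q2, prec_k (h q) (h q2) & fle q2 q') ->
  iso (Ak P k) Q.
Proof.
move=> [Qr Qa Qt] h_inj h_surj prec_le le_prec; apply: iso_sym.
exists h; split; first exact: inj_surj_bij.
move=> q q'; apply/idP/idP.
  (* Induction on the size of the interval from [q] to [q'], which loses at least [q] with each
     step. *)
  have [n] := ubnP #|[set z | fle q z && fle z q']|; elim: n q => // n IHn q.
  rewrite ltnS => le_n le_qq'; have [<-|neq_qq'] := eqVneq q q'; first exact: connect0.
  have [q2 prec_q2 le_q2] := le_prec _ _ le_qq' neq_qq'.
  apply: connect_trans (connect1 prec_q2) (IHn _ _ le_q2).
  apply: leq_trans le_n; apply: proper_card; apply/properP; split.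
    apply/subsetP => z; rewrite !inE => /andP[le_q2z ->]; rewrite andbT.
    exact: Qt (prec_le _ _ prec_q2) le_q2z.
  exists q; rewrite inE ?Qr ?le_qq' //=; apply/negP => /andP[le_q2q _].
  have eq_q := Qa _ _ (prec_le _ _ prec_q2) le_q2q.
  by move: prec_q2; rewrite -eq_q prec_irr.
move=> /connectP[p]; elim: p q => [|B p IHp] q /=.
  by move=> _ /h_inj ->; apply: Qr.
have [q2 <-] := h_surj B => /andP[/prec_le le_q2 pth] /IHp le_q2q'.
exact: Qt le_q2 (le_q2q' pth).
Qed.

Lemma A1_iso (P : fposet) : is_porder P -> iso (Ak P 1) P.
Proof.
move=> Pp; have [Pr _ _] := Pp.
have pf (x : P) : antichain [set x] && (#|[set x]| == 1).
  by rewrite cards1 andbT; apply/antichainP => y z /set1P-> /set1P->.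
apply: (@Ak_model P P 1 (fun x => exist _ [set x] (pf x))) => //.
- by move=> x y [/set1_inj].
- move=> A; have /andP[_ /cards1P[x Ax]] := valP A.
  by exists x; apply: val_inj.
- move=> x y /precP[a [b [/= /setP/(_ a) + /setP/(_ b) + /andP[ab _]]]].
  by rewrite !inE !eqxx => /andP[_ /eqP <-] /andP[_ /eqP <-].
- move=> x y le_xy neq_xy; exists y; last exact: Pr.
  apply/precP; exists x, y; split=> /=; last exact/andP.
    by apply/setP => z; rewrite !inE andbC; case: eqVneq => // ->.
  by apply/setP => z; rewrite !inE andbC; case: eqVneq => // ->; rewrite eq_sym.
Qed.

Lemma card_A0 (P : fposet) : #|Ak P 0| = 1.
Proof.
have pf : antichain (set0 : {set P}) && (#|(set0 : {set P})| == 0).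
  by rewrite cards0 andbT; apply/antichainP => x y; rewrite inE.
apply: (@eq_card1 _ (exist _ set0 pf : Ak P 0)) => A; rewrite !inE.
by apply/esym/eqP/val_inj => /=; have /andP[_ /eqP/cards0_eq] := valP A.
Qed.

(** * Increasing sequences *)

Definition increasing n k (f : {ffun 'I_k -> 'I_n}) : bool :=
  [forall i : 'I_k, forall j : 'I_k, (i < j) ==> (f i < f j)].

(** A model of [Cnk] that keeps the increasing enumeration of a subset instead of the subset itself,
    so that comparing or changing single entries does not go through [sort]. *)
Definition incfun (n k : nat) : fposet :=
  @FPoset {f : {ffun 'I_k -> 'I_n} | increasing f}
    (fun f g => [forall i, val f i <= val g i]).

Lemma increasingP n k (f : {ffun 'I_k -> 'I_n}) :
  reflect (forall i j : 'I_k, i < j -> f i < f j) (increasing f).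
Proof.
apply: (iffP forallP) => [ff i j|ff i]; first by have /forallP/(_ j)/implyP := ff i.
by apply/forallP => j; apply/implyP/ff.
Qed.

Lemma incfun_lt n k (f : incfun n k) (i j : 'I_k) : i < j -> val f i < val f j.
Proof. exact/increasingP/valP. Qed.

Lemma incfun_le n k (f : incfun n k) (i j : 'I_k) : i <= j -> val f i <= val f j.
Proof.
by rewrite leq_eqVlt => /predU1P[/val_inj->|/(incfun_lt f)/ltnW].
Qed.

Lemma incfun_inj n k (f : incfun n k) : injective (val f).
Proof.
move=> i j eq_f; case: (ltngtP i j) => [||/val_inj //] /(incfun_lt f);
by rewrite eq_f ltnn.
Qed.

Lemma incfun_porder n k : is_porder (incfun n k).
Proof.
split=> [f|f g|f g h]; rewrite /fle /=; first by apply/forallP => i.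
  move=> /forallP fg /forallP gf; apply/val_inj/ffunP => i.
  by apply/val_inj/eqP; rewrite eqn_leq fg gf.
move=> /forallP fg /forallP gh; apply/forallP => i.
exact: leq_trans (fg i) (gh i).
Qed.

Lemma incfun_im n k (X : {set 'I_n}) :
  #|X| = k -> exists f : incfun n k, val f @: setT = X.
Proof.
move=> card_X; pose f := [ffun i : 'I_k => enum_val (cast_ord (esym card_X) i)].
have f_inc : increasing f.
  apply/increasingP => i j lt_ij; rewrite !ffunE.
  have X_sorted : sorted (relpre (@nat_of_ord n) ltn) (enum X).
    rewrite /enum_mem -enumT; apply: sorted_filter.
      by move=> x y z; apply: ltn_trans.
    by rewrite -sorted_map val_enum_ord iota_ltn_sorted.
  rewrite !(enum_val_nth (f i)).
  apply: (sorted_ltn_nth _ _ X_sorted) => //; rewrite ?inE -?cardE ?card_X //.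
  by move=> x y z; apply: ltn_trans.
exists (exist _ f f_inc); apply/setP => x /=; apply/imsetP/idP.
  by case=> i _ ->; rewrite ffunE enum_valP.
move=> Xx; exists (cast_ord card_X (enum_rank_in Xx x)) => //.
by rewrite ffunE cast_ordK enum_rankK_in.
Qed.

(** Both sides are sorted and repetition-free with the same members, hence equal. *)
Lemma incseq_im n k (f : incfun n k) :
  incseq (val f @: setT) = [seq nat_of_ord (val f i) | i <- enum 'I_k].
Proof.
have sorted_f : sorted ltn [seq nat_of_ord (val f i) | i <- enum 'I_k].
  apply: (homo_sorted_in (e := relpre (@nat_of_ord k) ltn)) (allss _) _.
    by move=> i j _ _; apply: incfun_lt.
  by rewrite -sorted_map val_enum_ord iota_ltn_sorted.
apply: (sorted_eq leq_trans anti_leq); first exact/sort_sorted/leq_total.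
  by apply: sub_sorted sorted_f => x y; apply: ltnW.
rewrite perm_sort; apply: uniq_perm.
- by rewrite map_inj_uniq ?enum_uniq //; apply: val_inj.
- by rewrite map_inj_uniq ?enum_uniq // => i j /val_inj/incfun_inj.
move=> x; apply/mapP/mapP => [[y]|[i _ ->]].
  by rewrite mem_enum => /imsetP[i _ ->] ->; exists i; rewrite ?mem_enum.
by exists (val f i); rewrite // mem_enum imset_f.
Qed.

Lemma nth_incseq n k (f : incfun n k) (i : 'I_k) :
  nth 0 (incseq (val f @: setT)) i = val f i.
Proof. by rewrite incseq_im (nth_map i) ?size_enum_ord // nth_ord_enum. Qed.

Lemma incfun_Cnk n k : iso (incfun n k) (Cnk n k).
Proof.
have card_im (f : incfun n k) : #|val f @: setT| == k.
  by rewrite card_imset ?cardsT ?card_ord //; apply: incfun_inj.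
apply: (@iso_surj (incfun n k) (Cnk n k) (fun f => exist _ (val f @: setT) (card_im f))).
- exact: incfun_porder.
- move=> f g; rewrite /fle /=; apply: eq_forallb => i.
  by rewrite !nth_incseq.
- move=> X; have [f fX] := incfun_im (eqP (valP X)).
  by exists f; apply: val_inj.
Qed.

(* If [g i < f i], the [k - i] values [g (s j)] with [i <= j], all at least
   [f i], sit at indices above [i], of which there are only [k - i - 1]. *)
Lemma incfun_dominated n k (f g : incfun n k) (s : 'I_k -> 'I_k) :
  injective s -> (forall i, val f i <= val g (s i)) -> fle f g.
Proof.
move=> s_inj le_fg; apply/forallP => i; rewrite leqNgt; apply/negP => lt_gf.
have : #|s @: [set j : 'I_k | i <= j]| <= #|[set j : 'I_k | i < j]|.
  apply: subset_leq_card; apply/subsetP => _ /imsetP[j + ->]; rewrite !inE => le_ij.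
  rewrite ltnNge; apply/negP => /(incfun_le g) le_g.
  have := leq_trans (leq_trans (incfun_le f le_ij) (le_fg j)) le_g.
  by rewrite leqNgt lt_gf.
rewrite card_imset // leqNgt => /negP[]; apply: proper_card; apply/properP.
split; first by apply/subsetP => j; rewrite !inE => /ltnW.
by exists i; rewrite !inE ?ltnn.
Qed.

(** Take [i] to be the largest index with [f i < g i]. Above [i] the sequences agree, so raising
    entry [i] of [f] to [g i] keeps it below the next entry; the entries before [i] only get further
    away from it. *)
Lemma incfun_step n k (f g : incfun n k) : fle f g -> f != g ->
  exists i (h : incfun n k),
    [/\ val h i = val g i, forall j, j != i -> val h j = val f j,
        val f i < val g i & fle h g].
Proof.
move=> /forallP le_fg neq_fg.
have [i lt_i] : exists i, val f i < val g i.
  apply/existsP; apply: contraNT neq_fg => /existsPn ge_fg; apply/eqP/val_inj/ffunP => i.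
  by apply/val_inj/anti_leq; rewrite le_fg leqNgt ge_fg.
case: (@arg_maxnP _ i (fun i => val f i < val g i) val lt_i) => {lt_i}i lt_i max_i.
have eq_above (j : 'I_k) : i < j -> val f j = val g j.
  move=> lt_ij; apply/val_inj/anti_leq; rewrite le_fg leqNgt.
  by apply/negP => /max_i /= le_ji; rewrite ltnNge le_ji in lt_ij.
pose h := [ffun j => if j == i then val g i else val f j].
have h_inc : increasing h.
  apply/increasingP => j1 j2; rewrite !ffunE.
  case: eqVneq => [->|_]; case: eqVneq => [->|_]; rewrite ?ltnn // => lt_j.
  - by rewrite eq_above //; apply: incfun_lt.
  - exact: ltn_trans (incfun_lt f lt_j) lt_i.
  - exact: incfun_lt.
exists i, (exist _ h h_inc); split=> //=; first by rewrite ffunE eqxx.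
  by move=> j /negPf neq_j; rewrite ffunE neq_j.
by apply/forallP => j /=; rewrite ffunE; case: eqVneq => [->|].
Qed.

(** Sending [a] to [b] and fixing every other element maps [A] injectively into [B] and never goes
    down. Read through the enumerations [u] and [v], this map [phi] becomes the injection [s] of
    indices, in the form that [incfun_dominated] consumes. *)
Lemma prec_im (P : fposet) k (I : finType) (u v : I -> P) (A B : Ak_car P k) :
    (forall x : P, fle x x) -> injective u -> injective v ->
    val A = u @: setT -> val B = v @: setT -> prec_k A B ->
  exists2 s : I -> I, injective s & forall i, fle (u i) (v (s i)).
Proof.
move=> Pr u_inj v_inj Au Bv /precP[a [b [AB BA /andP[le_ab _]]]].
pose phi x := if x == a then b else x.
have bNA : b \notin val A by have /setP/(_ b) := BA; rewrite !inE eqxx => /andP[].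
have bB : b \in val B by have /setP/(_ b) := BA; rewrite !inE eqxx => /andP[].
have uA i : u i \in val A by rewrite Au imset_f.
have ex i : exists j, v j == phi (u i).
  suff: phi (u i) \in val B by rewrite Bv => /imsetP[j _ ->]; exists j.
  rewrite /phi; case: eqVneq => // neq_a; have /setP/(_ (u i)) := AB.
  by rewrite !inE uA (negPf neq_a) andbT => /negbFE.
pose s i := xchoose (ex i); have vs i : v (s i) = phi (u i) by apply/eqP/(xchooseP (ex i)).
exists s => [i j eq_s|i]; last by rewrite vs /phi; case: eqVneq => // ->.
have: phi (u i) = phi (u j) by rewrite -!vs eq_s.
rewrite /phi; case: eqVneq => [eq_i|_]; case: eqVneq => [eq_j|_] eq_ij.
- by apply: u_inj; rewrite eq_i.
- by rewrite eq_ij uA in bNA.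
- by rewrite -eq_ij uA in bNA.
- exact: u_inj.
Qed.

(** The converse direction for enumerated antichains: moving a single entry up is a step of
    [prec_k], since injectivity keeps the old and the new entry out of the other antichain. *)
Lemma prec_update (P : fposet) k (I : finType) (u v : I -> P) (A B : Ak_car P k) i :
    injective u -> injective v ->
    val A = u @: setT -> val B = v @: setT ->
    (forall j, j != i -> v j = u j) -> flt (u i) (v i) ->
  prec_k A B.
Proof.
move=> u_inj v_inj Au Bv eq_uv lt_i; have /andP[_ neq_i] := lt_i.
apply/precP; exists (u i), (v i); rewrite Au Bv; split=> //; apply/setP => x; rewrite !inE.
- apply/andP/eqP => [[vNx /imsetP[j _ def_x]]|->].
    rewrite def_x; congr u; apply/eqP; apply: contraNT vNx => /eq_uv.
    by rewrite def_x => <-; apply: imset_f.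
  split; last exact: imset_f.
  apply/imsetP => -[j _]; have [-> /eqP|neq_j] := eqVneq j i; first by rewrite (negPf neq_i).
  by rewrite eq_uv // => /u_inj eq_j; rewrite eq_j eqxx in neq_j.
- apply/andP/eqP => [[uNx /imsetP[j _ def_x]]|->].
    rewrite def_x; congr v; apply/eqP; apply: contraNT uNx => neq_j.
    by rewrite def_x eq_uv // imset_f.
  split; last exact: imset_f.
  apply/imsetP => -[j _]; have [-> /esym/eqP|neq_j] := eqVneq j i; first by rewrite (negPf neq_i).
  by rewrite -eq_uv // => /v_inj eq_j; rewrite eq_j eqxx in neq_j.
Qed.

(** * Antichains in subsets of a grid *)

(** The relation [d] cuts out a subset of the grid, so that one argument covers the whole grid ([d]
    constantly true) and the pairs [x < y] ([d] being [ltn]). *)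
Definition grid_sub (a b : nat) (d : rel nat) : fposet :=
  @FPoset {p : 'I_a * 'I_b | d p.1 p.2}
    (fun p q => ((val p).1 <= (val q).1) && ((val p).2 <= (val q).2)).

(** Along an antichain of a grid the second coordinate falls as the first one rises. Both
    coordinates are stored as increasing sequences, so [rev_ord] matches the entries belonging to
    one point. *)
Definition incpair (a b k : nat) (d : rel nat) : fposet :=
  @FPoset {q : incfun a k * incfun b k
            | [forall i, d (val q.1 i) (val q.2 (rev_ord i))]}
    (fun q r => fle (val q).1 (val r).1 && fle (val q).2 (val r).2).

Lemma grid_sub_porder a b d : is_porder (grid_sub a b d).
Proof.
split=> [p|p q|p q r]; rewrite /fle /=; first by rewrite !leqnn.
  move: p q => [[p1 p2] dp] [[q1 q2] dq] /= /andP[pq1 pq2] /andP[qp1 qp2].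
  apply/val_inj => /=.
  have -> : p1 = q1 by apply/val_inj/anti_leq/andP.
  by have -> : p2 = q2 by apply/val_inj/anti_leq/andP.
move=> /andP[pq1 pq2] /andP[qr1 qr2].
by rewrite (leq_trans pq1 qr1) (leq_trans pq2 qr2).
Qed.

Lemma incpair_porder a b k d : is_porder (incpair a b k d).
Proof.
have [Sr Sa St] := prodP_porder (incfun_porder a k) (incfun_porder b k).
split=> [q|q r|q r s]; first exact: Sr; last exact: St.
by move=> qr rq; apply/val_inj/Sa.
Qed.

Lemma ltn_rev_ord k (i j : 'I_k) : i < j -> rev_ord j < rev_ord i.
Proof. by move=> lt_ij; apply: ltn_sub2l => //; apply: leq_ltn_trans (ltn_ord j). Qed.

(** The pair [q] corresponds to the antichain of the points [u q i]. Climbing from [q] to [r] raises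
    the second sequence completely before the first one moves, which produces points [(x, y')] with
    the first coordinate from [q] and the second from [r]; the hypothesis on [d] keeps them in the
    subset. *)
Lemma Ak_grid_sub a b k (d : rel nat) :
    (forall x y x' y', x <= x' -> y <= y' -> d x y -> d x' y' -> d x y') ->
  iso (Ak (grid_sub a b d) k) (incpair a b k d).
Proof.
move=> d_step.
pose u (q : incpair a b k d) i : grid_sub a b d :=
  exist _ (val (val q).1 i, val (val q).2 (rev_ord i)) (forallP (valP q) i).
have u_inj q : injective (u q) by move=> i j [/incfun_inj].
have u_anti q : antichain [set u q i | i in setT] && (#|[set u q i | i in setT]| == k).
  rewrite card_imset // cardsT card_ord eqxx andbT; apply/antichainP.
  move=> _ _ /imsetP[i _ ->] /imsetP[j _ ->]; rewrite /fle /= => /andP[le1 le2].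
  case: (ltngtP i j) => [lt_ij|lt_ji|/val_inj->//].
    have lt_r : rev_ord j < rev_ord i by apply: ltn_rev_ord.
    by have := incfun_lt (val q).2 lt_r; rewrite ltnNge le2.
  by have := incfun_lt (val q).1 lt_ji; rewrite ltnNge le1.
pose h q : Ak (grid_sub a b d) k := exist _ [set u q i | i in setT] (u_anti q).
have h_fst q : [set (val p).1 | p in val (h q)] = val (val q).1 @: setT.
  by rewrite -imset_comp.
have h_snd q : [set (val p).2 | p in val (h q)] = val (val q).2 @: setT.
  rewrite -imset_comp; apply/setP => x; apply/imsetP/imsetP => -[i _ ->] /=.
    by exists (rev_ord i).
  by exists (rev_ord i); rewrite //= rev_ordK.
have im_inj n (f g : incfun n k) : val f @: setT = val g @: setT -> f = g.
  move=> eq_fg; apply/val_inj/ffunP => i; apply/val_inj.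
  by have := nth_incseq f i; rewrite eq_fg nth_incseq.
apply: (@Ak_model _ _ _ h); first exact: incpair_porder.
- move=> q r eq_h; apply: val_inj.
  have := h_fst q; have := h_snd q; rewrite eq_h h_fst h_snd => /im_inj eq2 /im_inj eq1.
  by rewrite [LHS]surjective_pairing -eq1 -eq2 -surjective_pairing.
- move=> A; have /andP[A_anti /eqP A_card] := valP A.
  (* Two points with the same first coordinate are comparable, so in an antichain they coincide. The
     first coordinates thus form a set of size [k], enumerated by [f]. *)
  have fst_inj : {in val A &, injective (fun p => (val p).1)}.
    move=> p q Ap Aq /= eq1; case/orP: (leq_total (val p).2 (val q).2) => le2.
      by apply: (antichainP _ A_anti); rewrite // /fle /= eq1 leqnn.
    by apply/esym/(antichainP _ A_anti); rewrite // /fle /= eq1 leqnn.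
  have [f f_im] := @incfun_im a k [set (val p).1 | p in val A]
    (etrans (card_in_imset fst_inj) A_card).
  have ex i : exists p, (p \in val A) && ((val p).1 == val f i).
    have : val f i \in val f @: setT by apply: imset_f.
    by rewrite f_im => /imsetP[p Ap ->]; exists p; rewrite Ap eqxx.
  pose p i := xchoose (ex i).
  have Ap i : p i \in val A by have /andP[] := xchooseP (ex i).
  have fst_p i : (val (p i)).1 = val f i by have /andP[_ /eqP] := xchooseP (ex i).
  pose g := [ffun i => (val (p (rev_ord i))).2].
  (* If [g] failed to increase, a point with smaller first coordinate would lie below one with
     larger first coordinate; the antichain would identify them, against strictness of [f]. *)
  have g_inc : increasing g.
    apply/increasingP => i j lt_ij; rewrite !ffunE ltnNge; apply/negP => le_ji.
    have lt_r : rev_ord j < rev_ord i by apply: ltn_rev_ord.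
    have lt_f := incfun_lt f lt_r.
    have eq_p : p (rev_ord j) = p (rev_ord i).
      apply: (antichainP _ A_anti) => //.
      by rewrite /fle /= !fst_p le_ji ltnW.
    by rewrite -!fst_p eq_p ltnn in lt_f.
  pose g' : incfun b k := exist _ g g_inc.
  have d_fg : [forall i, d (val f i) (val g' (rev_ord i))].
    by apply/forallP => i; rewrite /= ffunE rev_ordK -fst_p; apply: (valP (p i)).
  exists (exist _ (f, g') d_fg); apply/val_inj/eqP; rewrite eqEcard.
  have /andP[_ /eqP->] := u_anti (exist _ (f, g') d_fg); rewrite A_card leqnn andbT.
  apply/subsetP => _ /imsetP[i _ ->].
  suff -> : u (exist _ (f, g') d_fg) i = p i by [].
  apply: val_inj; rewrite /= ffunE rev_ordK -fst_p.
  by rewrite -surjective_pairing.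
(* One injection [s] of indices dominates both coordinates; for the second sequence it is conjugated
   by the reversal. *)
- move=> q r /(@prec_im _ _ _ _ _ (h q) (h r) _ (u_inj q) (u_inj r) erefl erefl)[|s s_inj le_s].
    by case: (grid_sub_porder a b d).
  apply/andP; split.
    by apply: (incfun_dominated s_inj) => i; have /andP[] := le_s i.
  apply: (@incfun_dominated _ _ _ _ (@rev_ord k \o s \o @rev_ord k)).
    by apply: inj_comp; [apply: inj_comp; [exact: rev_ord_inj|]|exact: rev_ord_inj].
  by move=> i; have /andP[_] := le_s (rev_ord i); rewrite /= rev_ordK.
- move=> q r /andP[le1 le2] neq_qr.
  (* The first sequence moves only once the second ones agree, so a changed point is a point of [r]
     and needs no hypothesis on [d]. *)
  have [eq2|neq2] := eqVneq (val q).2 (val r).2.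
    have neq1 : (val q).1 != (val r).1.
      apply: contraNneq neq_qr => eq1; apply/eqP/val_inj.
      by rewrite [LHS]surjective_pairing eq1 eq2 -surjective_pairing.
    have [i [f [f_i f_j lt_i le_f]]] := incfun_step le1 neq1.
    have d_f : [forall j, d (val f j) (val (val q).2 (rev_ord j))].
      apply/forallP => j; have [->|/f_j->] := eqVneq j i; last exact: (forallP (valP q) j).
      by rewrite f_i eq2; apply: (forallP (valP r) i).
    pose q2 : incpair a b k d := exist _ (f, (val q).2) d_f.
    exists q2; last by apply/andP.
    apply: (@prec_update _ _ _ (u q) (u q2) _ _ i) => //.
      by move=> j neq_j; apply: val_inj; rewrite /= f_j.
    rewrite /flt /fle /= f_i (ltnW lt_i) leqnn /=.
    by apply/eqP => -[eq_i]; move: lt_i; rewrite -f_i -eq_i ltnn.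
  have [i [g [g_i g_j lt_i le_g]]] := incfun_step le2 neq2.
  have d_g : [forall j, d (val (val q).1 j) (val g (rev_ord j))].
    apply/forallP => j.
    have [eq_j|/g_j->] := eqVneq (rev_ord j) i; last exact: (forallP (valP q) j).
    rewrite eq_j g_i -eq_j.
    apply: (d_step _ (val (val q).2 (rev_ord j)) (val (val r).1 j)).
    - exact: (forallP le1 j).
    - exact: (forallP le2 (rev_ord j)).
    - exact: (forallP (valP q) j).
    - exact: (forallP (valP r) j).
  pose q2 : incpair a b k d := exist _ ((val q).1, g) d_g.
  exists q2; last by apply/andP.
  apply: (@prec_update _ _ _ (u q) (u q2) _ _ (rev_ord i)) => //.
    move=> j neq_j; apply: val_inj; rewrite /= g_j //.
    by apply: contraNneq neq_j => <-; rewrite rev_ordK.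
  rewrite /flt /fle /= rev_ordK g_i (ltnW lt_i) leqnn /=.
  apply/eqP => -[]; rewrite !rev_ordK => eq_i; move: lt_i.
  by rewrite -g_i -eq_i ltnn.
Qed.

(** The condition compares only entry [i] of the first sequence with entry [rev_ord i] of the
    second, but monotonicity of the two sequences spreads it to all pairs of indices ([ltq]). Hence
    the concatenation is increasing. *)
Lemma incpair_concat n k : iso (incpair n n k ltn) (incfun n (k + k)).
Proof.
pose F (q : incpair n n k ltn) : {ffun 'I_(k + k) -> 'I_n} :=
  [ffun j => match split j with inl i => val (val q).1 i | inr i => val (val q).2 i end].
have Fl q i : F q (lshift k i) = val (val q).1 i.
  by rewrite ffunE (unsplitK (inl i)).
have Fr q i : F q (rshift k i) = val (val q).2 i.
  by rewrite ffunE (unsplitK (inr i)).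
have ltq (q : incpair n n k ltn) i j : val (val q).1 i < val (val q).2 j.
  have ltd i' : val (val q).1 i' < val (val q).2 (rev_ord i') := forallP (valP q) i'.
  case: (leqP i (rev_ord j)) => [le_ij|lt_ji].
    by apply: leq_ltn_trans (incfun_le _ le_ij) _; rewrite -[j in ltnRHS]rev_ordK.
  apply: ltn_trans (ltd i) (incfun_lt _ _).
  by rewrite -[j]rev_ordK; apply: ltn_rev_ord.
have F_inc q : increasing (F q).
  apply/increasingP => i j.
  rewrite -[i]splitK -[j]splitK; case: (split i) (split j) => [i'|i'] [j'|j'];
    rewrite [unsplit _]/= [unsplit _]/= ?Fl ?Fr.
  - exact: (@incfun_lt _ _ _ i' j').
  - by move=> _; apply: ltq.
  - by rewrite /= ltnNge (leq_trans (ltnW (ltn_ord j')) (leq_addr _ _)).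
  - by rewrite /= ltn_add2l; apply: incfun_lt.
apply: (@iso_surj _ (incfun n (k + k)) (fun q => exist _ (F q) (F_inc q))).
- exact: incpair_porder.
- move=> q r; apply/andP/forallP => [[/forallP le1 /forallP le2] j|le_F].
    by rewrite /= !ffunE; case: (split j).
  split; apply/forallP => i.
    by have := le_F (lshift k i); rewrite /= !Fl.
  by have := le_F (rshift k i); rewrite /= !Fr.
- move=> f; pose fl := [ffun i => val f (lshift k i)]; pose fr := [ffun i => val f (rshift k i)].
  have fl_inc : increasing fl.
    by apply/increasingP => i j lt_ij; rewrite !ffunE; apply: incfun_lt.
  have fr_inc : increasing fr.
    by apply/increasingP => i j lt_ij; rewrite !ffunE; apply: incfun_lt; rewrite /= ltn_add2l.
  pose q : incfun n k * incfun n k := (exist _ fl fl_inc, exist _ fr fr_inc).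
  have q_lt : [forall i, val q.1 i < val q.2 (rev_ord i)].
    apply/forallP => i; rewrite /= !ffunE; apply: incfun_lt => /=.
    exact: leq_trans (ltn_ord i) (leq_addr _ _).
  exists (exist _ q q_lt); apply/val_inj/ffunP => j /=.
  by rewrite -[j]splitK ffunE unsplitK; case: (split j) => i; rewrite ffunE.
Qed.

(** The case [k = 1] of the two preceding isomorphisms: antichains of size 1 recover the poset, and
    two sequences of length 1 concatenate to one of length 2. *)
Lemma grid_sub_Cnk2 n : iso (grid_sub n n ltn) (Cnk n 2).
Proof.
apply: iso_trans (incfun_Cnk n 2).
apply: iso_trans (incpair_concat n 1).
apply: iso_trans (iso_sym (A1_iso (grid_sub_porder n n ltn))) _.
by apply: Ak_grid_sub => x y x' y' _ le_y lt_xy _; apply: leq_trans lt_xy le_y.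
Qed.

Lemma incpair_true a b k :
  iso (incpair a b k (fun _ _ => true)) (prodP (Cnk a k) (Cnk b k)).
Proof.
apply: iso_trans (prodP_iso (incfun_Cnk a k) (incfun_Cnk b k)).
apply: (@iso_surj (incpair a b k _) (prodP (incfun a k) (incfun b k)) (fun q => val q)) => //.
  exact: incpair_porder.
move=> q; have q_true : [forall i, (fun _ _ => true) (val q.1 i) (val q.2 (rev_ord i))].
  by apply/forallP.
by exists (exist _ q q_true).
Qed.

Lemma grid_sub_true a b :
  iso (grid_sub a b (fun _ _ => true)) (prodP (chain a) (chain b)).
Proof.
apply: (@iso_surj (grid_sub a b _) (prodP (chain a) (chain b)) (fun p => val p)) => //.
  exact: grid_sub_porder.
by move=> p; exists (exist _ p isT).
Qed.

Lemma down_closed_initial n (p : pred nat) :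
    (forall i j, i <= j -> j < n -> p j -> p i) ->
  exists2 c, c <= n & forall i, i < n -> p i = (i < c).
Proof.
elim: n => [|n IHn] p_down; first by exists 0.
have [p_n|pN_n] := boolP (p n).
  by exists n.+1 => // i lt_i; rewrite lt_i (p_down i n).
have [i j le_ij lt_jn|c le_cn p_c] := IHn; first exact/p_down/ltnW.
exists c => [|i]; first exact: leqW.
rewrite ltnS leq_eqVlt => /predU1P[->|]; last exact: p_c.
by rewrite (negPf pN_n) ltnNge le_cn.
Qed.

(* The pair [(x, y)] with [x < y] encodes the ideal of [n] x [2] whose upper
   row has [x] elements and whose lower row has [y - 1]. *)
Lemma J_chain2 n : iso (grid_sub n.+2 n.+2 ltn) (J (prodP (chain n) (chain 2))).
Proof.
pose row (p : grid_sub n.+2 n.+2 ltn) (z : prodP (chain n) (chain 2)) :=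
  if z.2 == 0 :> nat then z.1.+1 < (val p).2 else z.1 < (val p).1.
have row_ideal p : is_ideal [set z | row p z].
  apply/idealP => -[i j] [i' j']; rewrite !inE /row /fle /= => /andP[le_i le_j].
  have [j0|_] := eqVneq (j : nat) 0.
    by move: le_j; rewrite j0 leqn0 => -> lt_i; apply: leq_ltn_trans lt_i; rewrite ltnS.
  case: eqP => _ lt_i; last exact: leq_ltn_trans lt_i.
  apply: leq_ltn_trans (valP p : (val p).1 < (val p).2).
  exact: leq_ltn_trans lt_i.
apply: (@iso_surj (grid_sub n.+2 n.+2 ltn) (J (prodP (chain n) (chain 2)))
          (fun p => exist _ [set z | row p z] (row_ideal p))).
- exact: grid_sub_porder.
- move=> p q; have le_n (r : grid_sub n.+2 n.+2 ltn) : (val r).1 <= n.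
    by have := leq_trans (valP r : (val r).1 < (val r).2) (ltn_ord (val r).2); rewrite ltnS.
  apply/andP/subsetP => [[le1 le2] [i j]|sub_pq].
    rewrite !inE /row /=; case: eqP => _ lt_i; [exact: leq_trans le2|exact: leq_trans le1].
  (* The witness is the first cell of the row that is missing from the ideal of [q]: column
     [(val q).1] in the upper row, column [(val q).2 - 1] in the lower one. *)
  split; rewrite leqNgt; apply/negP => lt_qp.
    have lt_n : (val q).1 < n := leq_trans lt_qp (le_n p).
    have := sub_pq (Ordinal lt_n, Ordinal (isT : 1 < 2)).
    by rewrite !inE /row /= lt_qp ltnn => /(_ isT).
  have q2_gt0 : 0 < (val q).2 by apply: leq_ltn_trans (valP q : (val q).1 < (val q).2).
  have lt_n : (val q).2.-1 < n.
    by rewrite -ltnS prednK // -ltnS; apply: leq_trans lt_qp (leq_ord _).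
  have := sub_pq (Ordinal lt_n, Ordinal (isT : 0 < 2)).
  by rewrite !inE /row /= prednK // lt_qp ltnn => /(_ isT).
- move=> A; have A_ideal := idealP _ (valP A).
  (* Row [j] of the ideal as a predicate on [nat], false from [n] on, to which [down_closed_initial]
     applies; the cut-offs [c0] and [c1] are the row lengths. *)
  pose col (j : 'I_2) i := [exists x : 'I_n, (val x == i) && ((x, j) \in val A)].
  have colE j (x : 'I_n) : col j x = ((x, j) \in val A).
    apply/existsP/idP => [[y /andP[/eqP/val_inj->]]//|Ax].
    by exists x; rewrite eqxx.
  have col_down j i1 i2 : i1 <= i2 -> i2 < n -> col j i2 -> col j i1.
    move=> le_i lt_i; rewrite (colE j (Ordinal lt_i)) (colE j (Ordinal (leq_ltn_trans le_i lt_i))).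
    by apply: A_ideal; rewrite /fle /= le_i leqnn.
  have [c0 le_c0 c0P] := down_closed_initial (col_down ord0).
  have [c1 le_c1 c1P] := down_closed_initial (col_down ord_max).
  have le_c10 : c1 <= c0.
    rewrite leqNgt; apply/negP => lt_c.
    have lt_n := leq_trans lt_c le_c1.
    have := c1P _ lt_n; rewrite lt_c (colE _ (Ordinal lt_n)) => A1.
    have := c0P _ lt_n; rewrite ltnn (colE _ (Ordinal lt_n)) => /negP[].
    by apply: A_ideal A1; rewrite /fle /= leqnn.
  have lt1 : c1 < n.+2 by rewrite ltnS leqW.
  have lt0 : c0.+1 < n.+2 by rewrite !ltnS.
  have lt_c : Ordinal lt1 < Ordinal lt0 by rewrite /= ltnS.
  exists (exist _ (Ordinal lt1, Ordinal lt0) lt_c); apply/val_inj/setP => -[i j].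
  rewrite inE /row /=; case: (eqVneq j ord0) => [->|neq_j] /=.
    by rewrite ltnS -c0P // colE.
  have -> : j = ord_max by apply: val_inj; case: j neq_j => [[|[]]].
  by rewrite /= -c1P // colE.
Qed.

(** * Distributive lattices *)

Lemma distributive_iso (P Q : fposet) :
  iso P Q -> distributive_lattice P -> distributive_lattice Q.
Proof.
move=> isoPQ [Pp [mt [jn [glb [lub dist]]]]]; split; first exact: iso_porder Pp.
have [f [[g gK fK] fle_f]] := isoPQ.
have gle_g x y : fle x y = fle (g x) (g y) by rewrite fle_f !fK.
exists (fun x y => f (mt (g x) (g y))), (fun x y => f (jn (g x) (g y))).
split; [|split] => [x y|x y|x y z]; last by rewrite !gK dist.
  have [lex [ley max]] := glb (g x) (g y).
  by do 2?split; rewrite ?gle_g ?gK // => z; rewrite !gle_g gK; apply: max.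
have [lex [ley min]] := lub (g x) (g y).
by do 2?split; rewrite ?gle_g ?gK // => z; rewrite !gle_g gK; apply: min.
Qed.

Lemma distributive_subsingleton (P : fposet) :
  (forall x : P, fle x x) -> (forall x y : P, x = y) -> distributive_lattice P.
Proof.
move=> Pr eqP; split.
  by split=> // x y z _ _; rewrite (eqP z x).
exists (fun x _ => x), (fun x _ => x); split; [|split] => // x y;
  by rewrite (eqP y x); do 2?split.
Qed.

(** Covers a unique antichain of size [k] as well as the absence of any. *)
Lemma distributive_Ak_card_le1 (P : fposet) k :
  #|Ak P k| <= 1 -> distributive_lattice (Ak P k).
Proof.
move=> /card_le1_eqP Ak_le1; apply: distributive_subsingleton => [A|A B].
  exact: connect0.
exact: Ak_le1.
Qed.

Lemma distributive_prod (P Q : fposet) :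
  distributive_lattice P -> distributive_lattice Q -> distributive_lattice (prodP P Q).
Proof.
move=> [Pp [mP [jP [glbP [lubP dP]]]]] [Qp [mQ [jQ [glbQ [lubQ dQ]]]]].
split; first exact: prodP_porder.
exists (fun x y => (mP x.1 y.1, mQ x.2 y.2)), (fun x y => (jP x.1 y.1, jQ x.2 y.2)).
split; [|split] => [x y|x y|x y z]; last by rewrite /= dP dQ.
  have [? [? maxP]] := glbP x.1 y.1; have [? [? maxQ]] := glbQ x.2 y.2.
  split; [|split] => [||z /andP[z1 z2] /andP[z3 z4]]; apply/andP; split=> //.
    exact: maxP.
  exact: maxQ.
have [? [? minP]] := lubP x.1 y.1; have [? [? minQ]] := lubQ x.2 y.2.
split; [|split] => [||z /andP[z1 z2] /andP[z3 z4]]; apply/andP; split=> //.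
  exact: minP.
exact: minQ.
Qed.

Definition ord_min n (i j : 'I_n) := if i <= j then i else j.
Definition ord_maxi n (i j : 'I_n) := if i <= j then j else i.

Lemma val_ord_min n (i j : 'I_n) : ord_min i j = minn i j :> nat.
Proof. by rewrite /ord_min; case: (leqP i j). Qed.

Lemma val_ord_maxi n (i j : 'I_n) : ord_maxi i j = maxn i j :> nat.
Proof. by rewrite /ord_maxi; case: (leqP i j). Qed.

(** Pointwise minima and maxima of strictly increasing sequences are strictly increasing, so
    distributivity is inherited entrywise from [minn] and [maxn]. *)
Lemma distributive_incfun n k : distributive_lattice (incfun n k).
Proof.
split; first exact: incfun_porder.
have min_inc (f g : incfun n k) : increasing [ffun i => ord_min (val f i) (val g i)].
  apply/increasingP => i j lt_ij; rewrite !ffunE !val_ord_min.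
  by rewrite leq_min !gtn_min !incfun_lt //= orbT.
have max_inc (f g : incfun n k) : increasing [ffun i => ord_maxi (val f i) (val g i)].
  apply/increasingP => i j lt_ij; rewrite !ffunE !val_ord_maxi.
  by rewrite gtn_max !leq_max !incfun_lt //= orbT.
exists (fun f g : incfun n k => exist _ [ffun i => ord_min (val f i) (val g i)] (min_inc f g)).
exists (fun f g : incfun n k => exist _ [ffun i => ord_maxi (val f i) (val g i)] (max_inc f g)).
split; [|split] => [f g|f g|f g h].
- split; [|split] => [||h /forallP hf /forallP hg]; apply/forallP => i;
    rewrite /= ffunE val_ord_min ?geq_minl ?geq_minr //.
  by rewrite leq_min hf hg.
- split; [|split] => [||h /forallP hf /forallP hg]; apply/forallP => i;
    rewrite /= ffunE val_ord_maxi ?leq_maxl ?leq_maxr //.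
  by rewrite geq_max hf hg.
- apply/val_inj/ffunP => i; apply: val_inj; rewrite /= !ffunE !val_ord_min !val_ord_maxi.
  by rewrite !val_ord_min minn_maxr.
Qed.

Lemma distributive_Cnk n k : distributive_lattice (Cnk n k).
Proof. exact: distributive_iso (incfun_Cnk n k) (distributive_incfun n k). Qed.

Lemma distributive_J (Q : fposet) : distributive_lattice (J Q).
Proof.
split; first exact: J_porder.
have I_ideal (A B : J Q) : is_ideal (val A :&: val B).
  apply/idealP => x y le_yx /setIP[Ax Bx].
  by apply/setIP; split; [apply: (idealP _ (valP A)) Ax | apply: (idealP _ (valP B)) Bx].
have U_ideal (A B : J Q) : is_ideal (val A :|: val B).
  apply/idealP => x y le_yx /setUP[Ax|Bx].
    by apply/setUP; left; apply: (idealP _ (valP A)) Ax.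
  by apply/setUP; right; apply: (idealP _ (valP B)) Bx.
exists (fun A B : J Q => exist _ (val A :&: val B) (I_ideal A B)).
exists (fun A B : J Q => exist _ (val A :|: val B) (U_ideal A B)).
split; [|split] => [A B|A B|A B C].
- split; [|split] => [||C CA CB]; first exact: subsetIl; first exact: subsetIr.
  by rewrite /fle /= subsetI; apply/andP.
- split; [|split] => [||C CA CB]; first exact: subsetUl; first exact: subsetUr.
  by rewrite /fle /= subUset; apply/andP.
- by apply/val_inj/setIUr.
Qed.

Lemma distributive_chain n : distributive_lattice (chain n).
Proof.
split; first exact: chain_porder.
exists (@ord_min n), (@ord_maxi n).
split; [|split] => [x y|x y|x y z]; rewrite ?/is_glb ?/is_lub /fle /=.
- by split; [|split] => [||z zx zy]; rewrite val_ord_min ?geq_minl ?geq_minr // leq_min zx.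
- by split; [|split] => [||z xz yz]; rewrite val_ord_maxi ?leq_maxl ?leq_maxr // geq_max xz.
- by apply: val_inj; rewrite /= !(val_ord_min, val_ord_maxi) minn_maxr.
Qed.

(** * Posets with a single incomparable pair *)

Definition incomparable (P : fposet) (x y : P) : bool := ~~ fle x y && ~~ fle y x.

Definition one_incomparable_pair (P : fposet) : Prop :=
  exists a b : P, a != b /\
    forall x y : P, incomparable x y = ((x, y) \in [:: (a, b); (b, a)]).

(** If ideals [A] and [B] are incomparable, pick [x] in [A] only and [y] in [B] only. These are
    incomparable, hence are [a] and [b] in some order, and [A] and [B] turn out to be the principal
    ideals of [x] and [y]. So the one incomparable pair of [J P] is [low a], [low b]. *)
Lemma one_pair_J (P : fposet) :
  is_porder P -> one_incomparable_pair P -> one_incomparable_pair (J P).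
Proof.
move=> [Pr Pa Pt] [a [b [neq_ab inc]]].
have low_ideal (x : P) : is_ideal [set z | fle z x].
  by apply/idealP => y z; rewrite !inE; apply: Pt.
pose low x : J P := exist _ [set z | fle z x] (low_ideal x).
have incC (x y : P) : incomparable x y = incomparable y x by rewrite /incomparable andbC.
have inc_uniq (x y z : P) : incomparable x y -> incomparable z x -> z = y.
  rewrite !inc !inE !xpair_eqE => /orP[]/andP[/eqP-> /eqP->] /orP[]/andP[/eqP-> /eqP eq_ab] //;
    by rewrite ?eq_ab ?eqxx in neq_ab.
have lowE (A B : J P) x y : x \in val A -> x \notin val B ->
    y \in val B -> y \notin val A -> incomparable x y /\ A = low x.
  move=> Ax BNx By ANy.
  have A_ideal := idealP _ (valP A); have B_ideal := idealP _ (valP B).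
  have xy : incomparable x y.
    apply/andP; split; apply/negP.
      by move=> le_xy; rewrite (B_ideal y x) in BNx.
    by move=> le_yx; rewrite (A_ideal x y) in ANy.
  split=> //; apply/val_inj/setP => z; rewrite inE.
  apply/idP/idP => [Az|]; last by move=> le_zx; apply: A_ideal Ax.
  apply: contraT => nle_zx; have [le_xz|nle_xz] := boolP (fle x z); last first.
    have zx : incomparable z x by rewrite /incomparable nle_zx.
    by rewrite (inc_uniq _ _ _ xy zx) (negPf ANy) in Az.
  have [le_yz|nle_yz] := boolP (fle y z); first by rewrite (A_ideal z y) in ANy.
  have [le_zy|nle_zy] := boolP (fle z y).
    by have /andP[/negP[]] := xy; apply: Pt le_zy.
  have zy : incomparable z y by rewrite /incomparable nle_zy nle_yz.
  rewrite incC in xy; rewrite (inc_uniq _ _ _ xy zy) in nle_zx.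
  by rewrite Pr in nle_zx.
have inc_ab : incomparable a b by rewrite inc !inE eqxx.
have inc_low (x y : P) : incomparable x y -> incomparable (low x) (low y).
  by case/andP=> nle_xy nle_yx; apply/andP; split; apply/subsetPn;
    [exists x | exists y]; rewrite ?inE.
exists (low a), (low b); split.
  by apply/eqP => eq_low; have := inc_low _ _ inc_ab; rewrite eq_low /incomparable /fle /= subxx.
move=> A B; apply/idP/idP; last first.
  by rewrite !inE !xpair_eqE => /orP[]/andP[/eqP-> /eqP->]; apply: inc_low; rewrite // incC.
move=> /andP[/subsetPn[x Ax BNx] /subsetPn[y By ANy]].
have [xy ->] := lowE _ _ _ _ Ax BNx By ANy; have [_ ->] := lowE _ _ _ _ By ANy Ax BNx.
by move: xy; rewrite inc !inE !xpair_eqE => /orP[]/andP[/eqP-> /eqP->]; rewrite !eqxx ?orbT.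
Qed.

Lemma one_pair_antichain (P : fposet) (A : {set P}) a b :
    a != b -> (forall x y : P, incomparable x y = ((x, y) \in [:: (a, b); (b, a)])) ->
    antichain A -> 1 < #|A| ->
  A = [set a; b].
Proof.
move=> neq_ab inc /antichainP A_anti A_gt1.
have A_inc x y : x \in A -> y \in A -> x != y -> (x, y) \in [:: (a, b); (b, a)].
  move=> Ax Ay neq_xy; rewrite -inc; apply/andP; split; apply: contra neq_xy => le_xy.
    by apply/eqP/A_anti.
  by rewrite eq_sym; apply/eqP/A_anti.
have [x [y [Ax Ay neq_xy]]] := card_gt1P A_gt1.
have /andP[Aa Ab] : (a \in A) && (b \in A).
  by move: Ax Ay (A_inc _ _ Ax Ay neq_xy); rewrite !inE !xpair_eqE => Ax Ay
    /orP[]/andP[/eqP <- /eqP <-]; rewrite Ax Ay.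
apply/setP => z; rewrite !inE; apply/idP/orP => [Az|[]/eqP-> //].
have [|neq_za] := eqVneq z a; [by left|right].
by have := A_inc _ _ Az Aa neq_za; rewrite !inE !xpair_eqE (negPf neq_za) /= => /andP[].
Qed.

Lemma card_A2_one_pair (P : fposet) :
  is_porder P -> one_incomparable_pair P -> #|Ak P 2| = 1.
Proof.
move=> [Pr _ _] [a [b [neq_ab inc]]].
have inc_ab : incomparable a b by rewrite inc !inE eqxx.
have ab_anti : antichain [set a; b] && (#|[set a; b]| == 2).
  rewrite cards2 neq_ab eqxx andbT; have /andP[nle_ab nle_ba] := inc_ab.
  by apply/antichainP => x y /set2P[]-> /set2P[]->; rewrite ?(negPf nle_ab) ?(negPf nle_ba).
apply: (@eq_card1 _ (exist _ [set a; b] ab_anti : Ak P 2)) => A; rewrite !inE.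
apply/esym/eqP/val_inj => /=; have /andP[A_anti /eqP A_card] := valP A.
by apply: (one_pair_antichain neq_ab inc A_anti); rewrite A_card.
Qed.

Lemma card_Ak_one_pair_gt2 (P : fposet) k :
  one_incomparable_pair P -> 2 < k -> #|Ak P k| = 0.
Proof.
move=> [a [b [neq_ab inc]]] k_gt2; apply: eq_card0 => A.
have /andP[A_anti /eqP A_card] := valP A.
have eqA : val A = [set a; b].
  by apply: (one_pair_antichain neq_ab inc A_anti); rewrite A_card ltnW.
by rewrite eqA cards2 neq_ab in A_card; rewrite -A_card in k_gt2.
Qed.

Lemma one_pair_square : one_incomparable_pair (prodP (chain 2) (chain 2)).
Proof.
exists (ord0, ord_max), (ord_max, ord0); split=> // -[x y] [x' y'].
by case: x => [[|[|[]]] ?]; case: y => [[|[|[]]] ?];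
  case: x' => [[|[|[]]] ?]; case: y' => [[|[|[]]] ?].
Qed.

Lemma Jpow_porder m (Q : fposet) : is_porder Q -> is_porder (Jpow m Q).
Proof. by case: m => //= m _; apply: J_porder. Qed.

Lemma one_pair_Jpow_square m :
  one_incomparable_pair (Jpow m (prodP (chain 2) (chain 2))).
Proof.
elim: m => [|m IHm]; first exact: one_pair_square.
apply: one_pair_J IHm; apply: Jpow_porder.
by apply: prodP_porder; apply: chain_porder.
Qed.

(** * Tabulated posets *)

(** The relation lives on [nat], so that finite checks can be evaluated on plain lists of
    numbers. *)
Definition tab (n : nat) (r : rel nat) : fposet := @FPoset 'I_n (fun i j => r i j).

(** The product order under row-by-row numbering: [i] stands for the point [(i %/ b, i %% b)]. *)
Definition grid_rel (b : nat) : rel nat :=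
  fun i j => (i %/ b <= j %/ b) && (i %% b <= j %% b).

Lemma chain_prod_tab a b :
  iso (prodP (chain a) (chain b.+1)) (tab (a * b.+1) (grid_rel b.+1)).
Proof.
have lt_ab (p : prodP (chain a) (chain b.+1)) : p.1 * b.+1 + p.2 < a * b.+1.
  by rewrite -ltn_divLR // divnMDl // divn_small // addn0.
have div_p (p : prodP (chain a) (chain b.+1)) : (p.1 * b.+1 + p.2) %/ b.+1 = p.1.
  by rewrite divnMDl // divn_small // addn0.
have mod_p (p : prodP (chain a) (chain b.+1)) : (p.1 * b.+1 + p.2) %% b.+1 = p.2.
  by rewrite modnMDl modn_small.
apply: (@iso_surj _ (tab (a * b.+1) _) (fun p => Ordinal (lt_ab p))).
- by apply: prodP_porder; apply: chain_porder.
- by move=> p q; rewrite /fle /= /grid_rel !div_p !mod_p.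
- move=> i; have lt_d : i %/ b.+1 < a by rewrite ltn_divLR.
  exists (Ordinal lt_d, Ordinal (ltn_pmod i (ltn0Sn b))); apply: val_inj.
  by rewrite /= -divn_eq.
Qed.

(** * Finite sets as increasing lists, and their enumeration *)

Definition ordseq n (A : {set 'I_n}) : seq nat := [seq val i | i <- enum A].

Lemma mem_ordseq n (A : {set 'I_n}) (i : 'I_n) : (val i \in ordseq A) = (i \in A).
Proof. by rewrite mem_map ?mem_enum //; apply: val_inj. Qed.

Lemma size_ordseq n (A : {set 'I_n}) : size (ordseq A) = #|A|.
Proof. by rewrite size_map cardE. Qed.

Lemma ordseq_inj n : injective (@ordseq n).
Proof. by move=> A B eqAB; apply/setP => i; rewrite -!mem_ordseq eqAB. Qed.

Lemma ordseqE n (A : {set 'I_n}) (p : pred nat) :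
  (forall i : 'I_n, (i \in A) = p i) -> ordseq A = [seq i <- iota 0 n | p i].
Proof.
move=> Ap; rewrite -val_enum_ord filter_map /ordseq; congr map.
rewrite {1}/enum_mem -enumT; apply: eq_filter => i; exact: Ap.
Qed.

Lemma ordseqD n (A B : {set 'I_n}) :
  ordseq (A :\: B) = [seq i <- ordseq A | i \notin ordseq B].
Proof.
rewrite (@ordseqE _ A (fun i => i \in ordseq A)) => [|i]; last by rewrite mem_ordseq.
rewrite -filter_predI; apply: ordseqE => i.
by rewrite inE /= !mem_ordseq.
Qed.

Definition setof n (s : seq nat) : {set 'I_n} := [set i | val i \in s].

Definition sublist n (s : seq nat) : bool := [seq i <- iota 0 n | i \in s] == s.

Lemma ordseq_setof n s : sublist n s -> ordseq (setof n s) = s.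
Proof. by move=> /eqP {2}<-; apply: ordseqE => i; rewrite inE. Qed.

(* All sublists of [l] built from left to right, where [ok] may veto an element
   in view of the elements already taken and already skipped. *)
Fixpoint subs (ok : seq nat -> seq nat -> nat -> bool) (l taken skipped : seq nat) :
    seq (seq nat) :=
  if l is x :: l' then
    subs ok l' taken (x :: skipped) ++
    (if ok taken skipped x then map (cons x) (subs ok l' (x :: taken) skipped) else [::])
  else [:: [::]].

(** Completeness of the search: [p] selects the wanted elements and [q] records what is known of the
    skipped ones. On the branch that follows [p], no veto ever occurs. *)
Lemma mem_subs (ok : seq nat -> seq nat -> nat -> bool) (p q : pred nat) l taken skipped :
    (forall t s x, all p t -> all q s -> p x -> ok t s x) ->
    {in l, forall x, ~~ p x -> q x} -> all p taken -> all q skipped ->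
  [seq x <- l | p x] \in subs ok l taken skipped.
Proof.
move=> ok_pq; elim: l taken skipped => [|x l IHl] t s q_l p_t q_s /=; first by rewrite inE.
have q_l' : {in l, forall y, ~~ p y -> q y} by move=> y ly; apply: q_l; rewrite inE ly orbT.
rewrite mem_cat; case: ifPn => p_x; last by rewrite IHl //= q_l ?mem_head.
by rewrite ok_pq // mem_map ?IHl ?orbT //= ?p_x // => ? ? [].
Qed.

Definition ideals n (r : rel nat) : seq (seq nat) :=
  subs (fun _ s x => ~~ has (fun y => r y x) s) (iota 0 n) [::] [::].

Definition antichains n (r : rel nat) : seq (seq nat) :=
  subs (fun t _ x => ~~ has (fun y => (y != x) && (r x y || r y x)) t) (iota 0 n) [::] [::].

Lemma mem_ideals n r (A : {set tab n r}) : is_ideal A -> ordseq A \in ideals n r.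
Proof.
move=> /idealP A_ideal; rewrite (@ordseqE _ _ (fun i => i \in ordseq A)) => [|i]; last first.
  by rewrite mem_ordseq.
apply: (mem_subs (q := fun y => (y < n) && (y \notin ordseq A))) => //; last first.
  by move=> y; rewrite mem_iota => /andP[_ ->].
move=> t s _ _ /allP s_A /mapP[x + ->]; rewrite mem_enum => Ax.
apply/hasP => -[y /s_A /andP[lt_yn yNA] r_yx]; case/negP: yNA.
by rewrite (mem_ordseq _ (Ordinal lt_yn)); apply: A_ideal Ax.
Qed.

Lemma mem_antichains n r (A : {set tab n r}) : antichain A -> ordseq A \in antichains n r.
Proof.
move=> /antichainP A_anti; rewrite (@ordseqE _ _ (fun i => i \in ordseq A)) => [|i]; last first.
  by rewrite mem_ordseq.
apply: (mem_subs (q := xpredT)) => // t s _ /allP t_A _ /mapP[x Ax ->].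
apply/hasP => -[_ /t_A/mapP[y + ->] /andP[neq_yx]]; rewrite !mem_enum in Ax * => Ay.
by case/orP=> [/(A_anti _ _ Ax Ay)|/(A_anti _ _ Ay Ax)] eq_xy; rewrite eq_xy eqxx in neq_yx.
Qed.

(** By [mem_ideals] the search misses no ideal, whatever the numbering. What is left to computation
    is that nothing is listed twice and that everything listed is an ideal. *)
Definition ideals_check n (r : rel nat) : bool :=
  uniq (ideals n r) &&
  all (fun s => sublist n s &&
         all (fun y => all (fun x => (x \in s) && r y x ==> (y \in s)) (iota 0 n)) (iota 0 n))
      (ideals n r).

Definition inclusion_table (L : seq (seq nat)) : seq (seq bool) :=
  [seq [seq all (mem t) s | t <- L] | s <- L].

Definition table_rel (T : seq (seq bool)) : rel nat :=
  fun i j => nth false (nth [::] T i) j.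

Lemma inclusion_tableE L s t : s \in L -> t \in L ->
  table_rel (inclusion_table L) (index s L) (index t L) = all (mem t) s.
Proof.
move=> Ls Lt; rewrite /table_rel (nth_map [::]) ?index_mem //.
by rewrite (nth_map [::]) ?index_mem // !nth_index.
Qed.

(** An ideal is numbered by its position in the enumeration. The table enters through an equation,
    so that an evaluated literal can serve as input for the next application of [J]. *)
Lemma J_tab n r T : ideals_check n r -> inclusion_table (ideals n r) = T ->
  iso (J (tab n r)) (tab (size T) (table_rel T)).
Proof.
move=> + <-; rewrite size_map; set L := ideals n r; case/andP=> L_uniq /allP L_ok.
have L_A (A : J (tab n r)) : ordseq (val A) \in L by apply/mem_ideals/valP.
have lt_L (A : J (tab n r)) : index (ordseq (val A)) L < size L by rewrite index_mem.
apply: (@iso_surj (J (tab n r)) (tab (size L) _) (fun A => Ordinal (lt_L A))).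
- exact: J_porder.
- move=> A B; rewrite [RHS]inclusion_tableE //.
  apply/subsetP/allP => [AB _ /mapP[x Ax ->]|AB x Ax].
    by rewrite mem_enum in Ax; rewrite [mem _ _]mem_ordseq AB.
  by rewrite -mem_ordseq; apply: AB; rewrite mem_ordseq.
- move=> i; have s_L := mem_nth [::] (ltn_ord i).
  have /andP[s_sub /allP s_down] := L_ok _ s_L.
  have A_ideal : is_ideal (setof n (nth [::] L i) : {set tab n r}).
    apply/idealP => x y r_yx; rewrite !inE => sx.
    have iota_ord (z : 'I_n) : val z \in iota 0 n by rewrite mem_iota ltn_ord.
    have /allP/(_ _ (iota_ord x))/implyP := s_down _ (iota_ord y).
    by rewrite sx; apply.
  exists (exist _ (setof n (nth [::] L i) : {set tab n r}) A_ideal); apply: val_inj.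
  by rewrite /= ordseq_setof // index_uniq.
Qed.

Definition precb (r : rel nat) (s t : seq nat) : bool :=
  match [seq x <- s | x \notin t], [seq x <- t | x \notin s] with
  | [:: a], [:: b] => r a b && (a != b)
  | _, _ => false
  end.

Lemma prec_precb n r k (A B : Ak (tab n r) k) :
  prec_k A B = precb r (ordseq (val A)) (ordseq (val B)).
Proof.
rewrite /precb -!ordseqD; apply/precP/idP => [[a [b [-> -> lt_ab]]]|].
  by rewrite /ordseq !enum_set1.
have set_of1 (C : {set 'I_n}) x : enum C = [:: x] -> C = [set x].
  by move=> enumC; apply/setP => y; rewrite -mem_enum enumC !inE.
rewrite /ordseq; case enumAB: (enum _) => [|a []] //; case enumBA: (enum _) => [|b []] //=.
by exists a, b; split=> //; apply: set_of1.
Qed.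

(** The hypotheses of [Ak_model] in executable form, with [h] sending [i] to entry [i] of [L]. The
    first four conditions make [L] a repetition-free list, of length [m], of all antichains of size
    [k]; the last two are the order conditions. *)
Definition antichains_check n (r : rel nat) k m (r' : rel nat) (L : seq (seq nat)) : bool :=
  [&& uniq L, size L == m,
      all (fun s => [&& sublist n s, size s == k &
             all (fun x => all (fun y => r x y ==> (x == y)) s) s]) L,
      all (fun s => (size s == k) ==> (s \in L)) (antichains n r),
      all (fun i => all (fun j =>
             precb r (nth [::] L i) (nth [::] L j) ==> r' i j) (iota 0 m)) (iota 0 m) &
      all (fun i => all (fun j => r' i j ==> (i == j) ||
             has (fun l => r' l j && precb r (nth [::] L i) (nth [::] L l)) (iota 0 m))
        (iota 0 m)) (iota 0 m)].

Lemma Ak_tab n r k m r' L :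
  is_porder (tab m r') -> antichains_check n r k m r' L ->
  iso (Ak (tab n r) k) (tab m r').
Proof.
move=> Tp /and5P[L_uniq /eqP size_L /allP L_ok /allP L_all /andP[/allP prec_le /allP le_prec]].
have iota_ord (i : 'I_m) : val i \in iota 0 m by rewrite mem_iota ltn_ord.
have L_i (i : 'I_m) : nth [::] L i \in L by rewrite mem_nth // size_L.
(* Beyond the end of [L] the default is the empty list, which is a [sublist] as well. *)
have sub_i i : sublist n (nth [::] L i).
  by have [lt_i|ge_i] := ltnP i (size L); [case/and3P: (L_ok _ (mem_nth [::] lt_i))
    | rewrite nth_default // /sublist; elim: (iota 0 n)].
have h_anti (i : 'I_m) : antichain (setof n (nth [::] L i) : {set tab n r})
    && (#|(setof n (nth [::] L i) : {set tab n r})| == k).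
  have /and3P[_ /eqP size_i /allP s_anti] := L_ok _ (L_i i).
  rewrite -size_ordseq ordseq_setof // size_i eqxx andbT.
  apply/antichainP => x y; rewrite !inE => sx sy r_xy.
  by have /allP/(_ _ sy)/implyP/(_ r_xy)/eqP/val_inj := s_anti _ sx.
pose h (i : tab m r') : Ak (tab n r) k :=
  exist _ (setof n (nth [::] L i) : {set tab n r}) (h_anti i).
have ordseq_h i : ordseq (val (h i)) = nth [::] L i by rewrite ordseq_setof.
apply: (@Ak_model _ _ _ h) => //.
- move=> i j eq_h; have := ordseq_h i; rewrite eq_h ordseq_h => /eqP.
  by rewrite nth_uniq ?size_L // => /eqP/val_inj.
- move=> A; have /andP[A_anti /eqP A_card] := valP A.
  have /implyP := L_all _ (mem_antichains A_anti).
  rewrite size_ordseq A_card eqxx => /(_ isT) LA.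
  have lt_A : index (ordseq (val A)) L < m by rewrite -size_L index_mem.
  by exists (Ordinal lt_A); apply/val_inj/ordseq_inj; rewrite ordseq_h nth_index.
- move=> i j; rewrite prec_precb !ordseq_h.
  by have /allP/(_ _ (iota_ord j))/implyP := prec_le _ (iota_ord i).
- move=> i j le_ij neq_ij.
  have /allP/(_ _ (iota_ord j))/implyP/(_ le_ij) := le_prec _ (iota_ord i).
  case/orP=> [/eqP/val_inj eq_ij|/hasP[l]]; first by rewrite eq_ij eqxx in neq_ij.
  rewrite mem_iota => lt_l /andP[le_lj prec_il].
  by exists (Ordinal lt_l : tab m r'); rewrite // prec_precb !ordseq_h.
Qed.

Lemma card_Ak_tab0 n r k :
  all (fun s => size s < k) (antichains n r) -> #|Ak (tab n r) k| = 0.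
Proof.
move=> /allP small; apply: eq_card0 => A; have /andP[A_anti /eqP A_card] := valP A.
by have := small _ (mem_antichains A_anti); rewrite size_ordseq A_card ltnn.
Qed.

(** * Iterated ideal posets of [2] x [2] and [2] x [3] *)

Definition square_table1 := Eval vm_compute in inclusion_table (ideals 4 (grid_rel 2)).
Definition square_table2 := Eval vm_compute in
  inclusion_table (ideals (size square_table1) (table_rel square_table1)).
Definition square_table3 := Eval vm_compute in
  inclusion_table (ideals (size square_table2) (table_rel square_table2)).

Definition rect_table1 := Eval vm_compute in inclusion_table (ideals 6 (grid_rel 3)).
Definition rect_table2 := Eval vm_compute in
  inclusion_table (ideals (size rect_table1) (table_rel rect_table1)).
Definition rect_table3 := Eval vm_compute in
  inclusion_table (ideals (size rect_table2) (table_rel rect_table2)).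

(** At each level [J_iso] carries the tabulation already found through one more [J], and [J_tab]
    tabulates the outcome. *)
Lemma Jpow3_square_tab :
  iso (Jpow 3 (prodP (chain 2) (chain 2))) (tab (size square_table3) (table_rel square_table3)).
Proof.
apply: (iso_trans (Jpow_iso 3 (chain_prod_tab 2 1))).
apply: iso_trans (J_iso _) (@J_tab (size square_table2) (table_rel square_table2) _ _ _).
- apply: iso_trans (J_iso _) (@J_tab (size square_table1) (table_rel square_table1) _ _ _).
  + by apply: J_tab; vm_compute.
  + by vm_compute.
  + by vm_compute.
- by vm_compute.
- by vm_compute.
Qed.

Lemma Jpow2_rect_tab :
  iso (Jpow 2 (prodP (chain 2) (chain 3))) (tab (size rect_table2) (table_rel rect_table2)).
Proof.
apply: (iso_trans (Jpow_iso 2 (chain_prod_tab 2 2))).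
apply: iso_trans (J_iso _) (@J_tab (size rect_table1) (table_rel rect_table1) _ _ _).
- by apply: J_tab; vm_compute.
- by vm_compute.
- by vm_compute.
Qed.

Lemma Jpow3_rect_tab :
  iso (Jpow 3 (prodP (chain 2) (chain 3))) (tab (size rect_table3) (table_rel rect_table3)).
Proof. by apply: iso_trans (J_iso Jpow2_rect_tab) (J_tab _ _); vm_compute. Qed.

(* Listed in the order that matches the numbering of [square_table3]. *)
Definition rect2_pairs : seq (seq nat) :=
  [:: [:: 3; 5]; [:: 4; 5]; [:: 4; 6]; [:: 4; 8]; [:: 4; 11]; [:: 7; 8]; [:: 7; 11];
      [:: 9; 11]; [:: 10; 11]; [:: 10; 12]].

(* Listed in the order that matches the numbering of [rect_table3]. *)
Definition rect3_pairs : seq (seq nat) :=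
  [:: [:: 4; 5]; [:: 4; 10]; [:: 6; 10]; [:: 7; 10]; [:: 7; 11]; [:: 8; 10]; [:: 8; 11];
      [:: 8; 12]; [:: 8; 15]; [:: 13; 15]; [:: 9; 10]; [:: 9; 11]; [:: 9; 12]; [:: 9; 15];
      [:: 14; 15]; [:: 9; 13]; [:: 9; 16]; [:: 14; 16]; [:: 9; 18]; [:: 14; 18]; [:: 17; 18];
      [:: 9; 21]; [:: 14; 21]; [:: 17; 21]; [:: 19; 21]; [:: 20; 21]; [:: 20; 22]].

Lemma A2_Jpow2_rect :
  iso (Ak (Jpow 2 (prodP (chain 2) (chain 3))) 2) (Jpow 3 (prodP (chain 2) (chain 2))).
Proof.
apply: iso_trans (Ak_iso 2 Jpow2_rect_tab) (iso_trans _ (iso_sym Jpow3_square_tab)).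
(* That the table is a partial order is transported from [J] rather than computed. *)
apply: (Ak_tab (L := rect2_pairs)); first exact: iso_porder Jpow3_square_tab (J_porder _).
by vm_compute.
Qed.

Lemma A2_Jpow3_rect :
  iso (Ak (Jpow 3 (prodP (chain 2) (chain 3))) 2) (Jpow 3 (prodP (chain 2) (chain 3))).
Proof.
apply: iso_trans (Ak_iso 2 Jpow3_rect_tab) (iso_trans _ (iso_sym Jpow3_rect_tab)).
apply: (Ak_tab (L := rect3_pairs)); first exact: iso_porder Jpow3_rect_tab (J_porder _).
by vm_compute.
Qed.

Lemma card_A3_Jpow3_rect : #|Ak (Jpow 3 (prodP (chain 2) (chain 3))) 3| = 1.
Proof.
rewrite (iso_card (Ak_iso 3 Jpow3_rect_tab)).
have /iso_card -> : iso (Ak (tab (size rect_table3) (table_rel rect_table3)) 3)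
                        (tab 1 (fun _ _ => true)).
  (* The only antichain of size 3, in the numbering of [rect_table3], matched with the one-point
     poset. *)
  apply: (Ak_tab (L := [:: [:: 9; 13; 15]])); last by vm_compute.
  by split=> // x y _ _; rewrite !ord1.
exact: card_ord.
Qed.

Lemma card_Ak_Jpow2_rect_gt2 k :
  2 < k -> #|Ak (Jpow 2 (prodP (chain 2) (chain 3))) k| = 0.
Proof.
move=> k_gt2; rewrite (iso_card (Ak_iso k Jpow2_rect_tab)); apply: card_Ak_tab0.
have: all (fun s => size s <= 2) (antichains (size rect_table2) (table_rel rect_table2)).
  by vm_compute.
by apply: sub_all => s /leq_ltn_trans; apply.
Qed.

Lemma card_Ak_Jpow3_rect_gt3 k :
  3 < k -> #|Ak (Jpow 3 (prodP (chain 2) (chain 3))) k| = 0.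
Proof.
move=> k_gt3; rewrite (iso_card (Ak_iso k Jpow3_rect_tab)); apply: card_Ak_tab0.
have: all (fun s => size s <= 3) (antichains (size rect_table3) (table_rel rect_table3)).
  by vm_compute.
by apply: sub_all => s /leq_ltn_trans; apply.
Qed.

(** * The minuscule posets *)

Lemma Ak_grid a b k :
  iso (Ak (prodP (chain a) (chain b)) k) (prodP (Cnk a k) (Cnk b k)).
Proof.
apply: iso_trans (Ak_iso k (iso_sym (grid_sub_true a b))) _.
by apply: iso_trans (Ak_grid_sub _ _ _ _) (incpair_true a b k).
Qed.

Lemma Ak_Cnk2 n k : iso (Ak (Cnk n 2) k) (Cnk n (2 * k)).
Proof.
apply: iso_trans (Ak_iso k (iso_sym (grid_sub_Cnk2 n))) _.
rewrite mul2n -addnn.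
apply: iso_trans (iso_trans (Ak_grid_sub _ _ _ _) (incpair_concat n k)) (incfun_Cnk _ _).
by move=> x y x' y' _ le_y lt_xy _; apply: leq_trans lt_xy le_y.
Qed.

Lemma distributive_Jpow m a b : distributive_lattice (Jpow m (prodP (chain a) (chain b))).
Proof.
case: m => [|m] /=; last exact: distributive_J.
by apply: distributive_prod; apply: distributive_chain.
Qed.

Lemma Jpow_grid_porder m a b : is_porder (Jpow m (prodP (chain a) (chain b))).
Proof. by apply/Jpow_porder/prodP_porder; apply: chain_porder. Qed.

Lemma distributive_A1 (P : fposet) :
  distributive_lattice P -> distributive_lattice (Ak P 1).
Proof. by move=> dP; have [Pp _] := dP; apply: distributive_iso (iso_sym (A1_iso Pp)) dP. Qed.

(** In every family the antichain poset is isomorphic to a [Cnk], to a product of two of them or to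
    a [Jpow] of a grid, or else has at most one element. *)
Lemma distributive_Ak_minuscule (P : fposet) k :
  irreducible_minuscule P -> distributive_lattice (Ak P k).
Proof.
have le1 Q n : #|Ak Q n| = 1 -> #|Ak Q n| <= 1 by move->.
have le0 Q n : #|Ak Q n| = 0 -> #|Ak Q n| <= 1 by move->.
case=> [[a [b [_ [_]]]]|[[n [_]]|[[m]|[]]]] isoP;
  apply: distributive_iso (iso_sym (Ak_iso k isoP)) _.
- apply: distributive_iso (iso_sym (Ak_grid a b k)) _.
  by apply: distributive_prod; apply: distributive_Cnk.
- apply: distributive_iso (Ak_iso k (J_chain2 n)) _.
  apply: distributive_iso (iso_sym (Ak_iso k (grid_sub_Cnk2 _))) _.
  exact: distributive_iso (iso_sym (Ak_Cnk2 _ k)) (distributive_Cnk _ _).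
- have one_pair := one_pair_Jpow_square m.
  case: k => [|[|[|k]]].
  + exact/distributive_Ak_card_le1/le1/card_A0.
  + exact/distributive_A1/distributive_Jpow.
  + apply/distributive_Ak_card_le1/le1/card_A2_one_pair => //; exact: Jpow_grid_porder.
  + exact/distributive_Ak_card_le1/le0/card_Ak_one_pair_gt2.
- case: k => [|[|[|k]]].
  + exact/distributive_Ak_card_le1/le1/card_A0.
  + exact/distributive_A1/distributive_Jpow.
  + exact: distributive_iso (iso_sym A2_Jpow2_rect) (distributive_Jpow 3 2 2).
  + exact/distributive_Ak_card_le1/le0/card_Ak_Jpow2_rect_gt2.
- case: k => [|[|[|[|k]]]].
  + exact/distributive_Ak_card_le1/le1/card_A0.
  + exact/distributive_A1/distributive_Jpow.
  + exact: distributive_iso (iso_sym A2_Jpow3_rect) (distributive_Jpow 3 2 3).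
  + exact/distributive_Ak_card_le1/le1/card_A3_Jpow3_rect.
  + exact/distributive_Ak_card_le1/le0/card_Ak_Jpow3_rect_gt3.
Qed.

Theorem theorem4p2 (P : fposet) (k : nat) :
  irreducible_minuscule P -> k <= width P ->
  (* (i) *)
      (forall a b, 0 < a -> 0 < b -> iso P (prodP (chain a) (chain b)) ->
         iso (Ak P k) (prodP (Cnk a k) (Cnk b k))) /\
      (* (ii) *)
      (forall n, 0 < n -> iso P (J (prodP (chain n) (chain 2))) ->
         iso (Ak P k) (Ak (Cnk n.+2 2) k) /\ iso (Ak (Cnk n.+2 2) k) (Cnk n.+2 (2 * k))) /\
      (* (iii) *)
      (forall m, iso P (Jpow m (prodP (chain 2) (chain 2))) ->
         ((k = 0 \/ k = 2) -> #|Ak P k| = 1) /\ (k = 1 -> iso (Ak P k) P)) /\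
      (* (iv) *)
      (iso P (Jpow 2 (prodP (chain 2) (chain 3))) ->
         (k = 0 -> #|Ak P k| = 1) /\ (k = 1 -> iso (Ak P k) P) /\
             (k = 2 -> iso (Ak P k) (Jpow 3 (prodP (chain 2) (chain 2))))) /\
      (* (v) *)
      (iso P (Jpow 3 (prodP (chain 2) (chain 3))) ->
         ((k = 0 \/ k = 3) -> #|Ak P k| = 1) /\ ((k = 1 \/ k = 2) -> iso (Ak P k) P)) /\
      (* (vi) *)
      distributive_lattice (Ak P k).
Proof.
move=> P_min _.
have A1 Q : is_porder Q -> iso P Q -> k = 1 -> iso (Ak P k) P.
  by move=> Qp isoP ->; apply/A1_iso/(iso_porder (iso_sym isoP)).
split=> [a b _ _ isoP|].
  exact: iso_trans (Ak_iso k isoP) (Ak_grid a b k).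
split=> [n _ isoP|].
  split; last exact: Ak_Cnk2.
  exact/Ak_iso/(iso_trans isoP)/(iso_trans (iso_sym (J_chain2 n)))/grid_sub_Cnk2.
split=> [m isoP|].
  split=> [[]->|]; [exact: card_A0| |exact: A1 (Jpow_grid_porder m 2 2) isoP].
  rewrite (iso_card (Ak_iso 2 isoP)); apply: card_A2_one_pair (one_pair_Jpow_square m).
  exact: Jpow_grid_porder.
split=> [isoP|].
  split=> [->|]; first exact: card_A0.
  split=> [|->]; first exact: A1 (Jpow_grid_porder 2 2 3) isoP.
  exact: iso_trans (Ak_iso 2 isoP) A2_Jpow2_rect.
split=> [isoP|]; last exact: distributive_Ak_minuscule.
split=> [[]->|[|->]]; first exact: card_A0.
- by rewrite (iso_card (Ak_iso 3 isoP)) card_A3_Jpow3_rect.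
- exact: A1 (Jpow_grid_porder 3 2 3) isoP.
- exact: iso_trans (iso_trans (Ak_iso 2 isoP) A2_Jpow3_rect) (iso_sym isoP).
Qed.
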